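(* Let $p>0$ be a real number and let $n$ be a positive integer. Then $$n^p\binom{2n}{n}\;\leq\; S_p(n)\;\leq\; \left[n^p\,\frac{2n+1}{n+1}+n\right]\binom{2n}{n},$$ where $S_p(n)=\sum_{j=1}^n j^p\binom{n+j}{j}$.
   Context: For a real number $p>0$ and a positive integer $n$, the binomial sum $S_p(n)$ is defined by $S_p(n)=\sum_{j=1}^n j^p\binom{n+j}{j}$. *)

(* Defs.v *)
From mathcomp Require Import all_boot all_order all_algebra.
From mathcomp Require Import reals exp.

Set Implicit Arguments.
Unset Strict Implicit.
Unset Printing Implicit Defensive.

Import Order.TTheory GRing.Theory Num.Theory.
Local Open Scope ring_scope.

Definition binomial_sum (R : realType) (p : R) (n : nat) : R :=
  \sum_(1 <= j < n.+1) j%:R `^ p * 'C(n + j, j)%:R.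

(* Main.v *)
Require Import Defs.
From mathcomp Require Import all_boot all_order all_algebra.
From mathcomp Require Import reals exp.

(** The function [j |-> j ^ p] is nonnegative and, as [p > 0], nondecreasing.
    The lower bound keeps only the term [j = n] of the sum.  For the upper
    bound, each weight [j ^ p] is replaced by the largest one, [n ^ p]; what
    remains is a sum of binomial coefficients along a diagonal of Pascal's
    triangle, which [sum_bin_diag] evaluates to [C(2n+1, n)], and
    [C(2n+1, n) = (2n+1)/(n+1) * C(2n, n)].  This gives the upper bound with
    the nonnegative summand [n * C(2n, n)] to spare. *)

Import Order.TTheory GRing.Theory Num.Theory.
Local Open Scope ring_scope.

(** Hockey-stick identity: Pascal's rule absorbs one more term at each step. *)
Lemma sum_bin_diag (n m : nat) :
  (\sum_(0 <= j < m.+1) 'C(n + j, j) = 'C((n + m).+1, m))%N.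
Proof.
elim: m => [|m IHm]; first by rewrite big_nat1 !bin0.
by rewrite big_nat_recr //= IHm addnS [RHS]binS addnC.
Qed.

Lemma mul_central_bin (n : nat) :
  ((n + 1) * 'C((n + n).+1, n) = (2 * n + 1) * 'C(2 * n, n))%N.
Proof.
have := mul_bin_down (n + n).+1 n.
by rewrite -addSn addnK addSn mul2n -addnn !addn1 => <-.
Qed.

Lemma binomial_sum_ge_last (R : realType) (p : R) (n : nat) :
  (0 < n)%N -> n%:R `^ p * 'C(2 * n, n)%:R <= binomial_sum p n.
Proof.
move=> n_gt0; rewrite /binomial_sum big_nat_recr //= addnn -mul2n lerDr.
by apply: sumr_ge0 => j _; rewrite mulr_ge0 ?powR_ge0.
Qed.

Lemma binomial_sum_le_diag (R : realType) (p : R) (n : nat) :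
  0 <= p -> binomial_sum p n <= n%:R `^ p * 'C((n + n).+1, n)%:R.
Proof.
move=> p_ge0; rewrite -sum_bin_diag natr_sum mulr_sumr big_nat_recl //.
(* The diagonal sum starts at j = 0, which contributes a nonnegative term. *)
rewrite /binomial_sum big_add1 /=.
apply: ler_wpDl; first by rewrite mulr_ge0 ?powR_ge0.
apply: ler_sum_nat => j /andP[_ lt_jn].
by rewrite ler_wpM2r // ge0_ler_powR ?nnegrE ?ler_nat.
Qed.

Theorem theorem2p1 (R : realType) (p : R) (n : nat) (hp : 0 < p) (hn : (0 < n)%N) :
  n%:R `^ p * 'C(2 * n, n)%:R <= binomial_sum p n /\
  binomial_sum p n <=
    (n%:R `^ p * ((2 * n + 1)%:R / (n + 1)%:R) + n%:R) * 'C(2 * n, n)%:R.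
Proof.
split; first exact: binomial_sum_ge_last.
apply: le_trans (binomial_sum_le_diag R p n (ltW hp)) _.
have n1_neq0 : (n + 1)%:R != 0 :> R by rewrite pnatr_eq0 addn1.
have -> : 'C((n + n).+1, n)%:R
    = (2 * n + 1)%:R / (n + 1)%:R * 'C(2 * n, n)%:R :> R.
  by apply: (mulfI n1_neq0); rewrite -natrM mul_central_bin natrM mulrA mulrCA divff // mulr1.
by rewrite mulrDl mulrA lerDl mulr_ge0.
Qed.
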